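(* Let $k\geq 2$ be an integer and let $G$ be a graph of order $n\geq 3(k+1)\delta+5$ with minimum degree $\delta$. If $$\rho(G)\geq \rho\big(K_{\delta}\vee (K_{n-k\delta-\delta-1}+(k\delta+1)K_1)\big),$$ then $G$ has a $\{K_{1,1},K_{1,2},\ldots,K_{1,k}\}$-factor unless $G\cong K_{\delta}\vee (K_{n-k\delta-\delta-1}+(k\delta+1)K_1)$.
   Context: All graphs are finite, simple and undirected. $\rho(G)$ denotes the spectral radius of $G$, i.e. the largest eigenvalue of its adjacency matrix. For a set $\mathcal{F}$ of graphs, an $\mathcal{F}$-factor of $G$ is a spanning subgraph of $G$ each component of which is isomorphic to a member of $\mathcal{F}$. $K_{1,j}$ is the star with $j+1$ vertices, $K_m$ the complete graph on $m$ vertices, $mK_1$ the edgeless graph on $m$ vertices, $G_1+G_2$ the disjoint union, and $G_1\vee G_2$ the join (disjoint union plus all edges between $V(G_1)$ and $V(G_2)$). *)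

(* Defs.v *)
From HB Require Import structures.
From mathcomp Require Import all_boot all_order all_algebra.
From mathcomp Require Import classical_sets reals.

Set Implicit Arguments.
Unset Strict Implicit.
Unset Printing Implicit Defensive.

Import Order.TTheory GRing.Theory Num.Theory.

Record sgraph := SGraph {
  vertex :> finType;
  adj : rel vertex;
  adj_sym : symmetric adj;
  adj_irrefl : irreflexive adj }.

Definition iso (G H : sgraph) : Prop :=
  exists2 f : G -> H, bijective f & forall x y, adj (f x) (f y) = adj x y.

Section Complete.
Variable m : nat.

Definition complete_rel : rel 'I_m := fun x y => x != y.

Lemma complete_sym : symmetric complete_rel.
Proof. by move=> x y; rewrite /complete_rel eq_sym. Qed.

Lemma complete_irrefl : irreflexive complete_rel.
Proof. by move=> x; rewrite /complete_rel eqxx. Qed.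

Definition complete := SGraph complete_sym complete_irrefl.

Definition edgeless_rel : rel 'I_m := fun _ _ => false.

Lemma edgeless_sym : symmetric edgeless_rel.
Proof. by []. Qed.

Lemma edgeless_irrefl : irreflexive edgeless_rel.
Proof. by []. Qed.

Definition edgeless := SGraph edgeless_sym edgeless_irrefl.

End Complete.

Section Sum.
Variables G H : sgraph.

(* [b] tells whether the two sides are completely joined or not joined. *)
Definition sum_rel (b : bool) : rel (G + H)%type := fun u v =>
  match u, v with
  | inl x, inl y => adj x y
  | inr x, inr y => adj x y
  | _, _ => b
  end.

Lemma sum_rel_sym b : symmetric (sum_rel b).
Proof. by case=> x [] y //=; apply: adj_sym. Qed.

Lemma sum_rel_irrefl b : irreflexive (sum_rel b).
Proof. by case=> x /=; apply: adj_irrefl. Qed.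

Definition disjoint_union :=
  SGraph (sum_rel_sym false) (sum_rel_irrefl false).

Definition join := SGraph (sum_rel_sym true) (sum_rel_irrefl true).

End Sum.

Section Induced.
Variables (G : sgraph) (A : {set G}).

Definition induced_rel : rel {x : G | x \in A} :=
  fun u v => adj (val u) (val v).

Lemma induced_sym : symmetric induced_rel.
Proof. by move=> u v; apply: adj_sym. Qed.

Lemma induced_irrefl : irreflexive induced_rel.
Proof. by move=> u; apply: adj_irrefl. Qed.

Definition induced := SGraph induced_sym induced_irrefl.

End Induced.

Definition component (G : sgraph) (x : G) : sgraph :=
  induced [set y | connect (@adj G) x y].

Definition has_factor (F : sgraph -> Prop) (G : sgraph) : Prop :=
  exists (e : rel G) (e_sym : symmetric e) (e_irrefl : irreflexive e),
    subrel e (@adj G) /\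
    forall x : SGraph e_sym e_irrefl, exists2 S, F S & iso (component x) S.

Definition star (j : nat) : sgraph := join (complete 1) (edgeless j).

Definition stars_upto (k : nat) (S : sgraph) : Prop :=
  exists2 j, 1 <= j <= k & S = star j.

Definition degree (G : sgraph) (x : G) : nat := #|[set y | adj x y]|.

(* Every degree is smaller than #|G|, so the default value of the minimum
   only matters when G has no vertex. *)
Definition min_degree (G : sgraph) : nat := \big[minn/#|G|]_(x : G) degree x.

Definition adjacency (R : realType) (G : sgraph) : 'M[R]_#|G| :=
  (\matrix_(i, j) (adj (enum_val i) (enum_val j))%:R)%R.

(* The set of real eigenvalues is finite, and nonempty as soon as G has a
   vertex because the matrix is symmetric; the supremum is then a maximum. *)
Definition spectral_radius (R : realType) (G : sgraph) : R :=
  sup [set a | eigenvalue (adjacency R G) a]%classic.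

Definition extremal (k n d : nat) : sgraph :=
  join (complete d)
    (disjoint_union (complete (n - k * d - d - 1)) (edgeless (k * d + 1))).

(* Main.v *)
Require Import Defs.
From mathcomp Require Import boolp classical_sets.
From mathcomp Require Import all_boot all_order all_algebra.
From mathcomp Require Import reals polyrcf.
From mathcomp Require Import zify ring lra.

Set Implicit Arguments.
Unset Strict Implicit.
Unset Printing Implicit Defensive.

Import Order.TTheory GRing.Theory Num.Theory.

(* If every independent set [I] satisfies [|I| <= k |N(I)|], then Hall's theorem
   gives a map sending each vertex to a neighbour, with fibres of size at most
   [k]; its functional digraph is cut into stars from the leaves upwards.
   Otherwise some independent [I] with [|I| = k |S| + 1] has its neighbours in a
   set [S] of size [s >= delta], so [G] is a spanning subgraph of the graph
   [H_s] obtained by joining a clique on [S] to the disjoint union of [I] and a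
   clique. The spectral radius [x] of the extremal graph [H_delta] is a root of
   a cubic, and the corresponding vector on [H_s], constant on [S], on [I] and
   on the rest, is positive and satisfies [A v <= x v], strictly on [S] when
   [s > delta]. Comparing an eigenvector of [G] for an eigenvalue at least [x]
   with [v] where their ratio is largest forces [s = delta] and [G = H_s]. *)

(** * Hall's theorem and star covers *)

Section Hall.
Variables (T U : finType) (r : T -> U -> bool).

Definition rel_image (X : {set T}) : {set U} := [set u | [exists x in X, r x u]].

Lemma rel_imageP (X : {set T}) u :
  reflect (exists2 x, x \in X & r x u) (u \in rel_image X).
Proof. by rewrite inE; exact: exists_inP. Qed.

Lemma rel_imageU X Y : rel_image (X :|: Y) = rel_image X :|: rel_image Y.
Proof.
apply/setP=> u; rewrite in_setU; apply/rel_imageP/orP.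
  case=> x; rewrite in_setU => /orP[] xX xu; [left|right];
    by apply/rel_imageP; exists x.
by case=> /rel_imageP[x xX xu]; exists x => //; rewrite in_setU xX ?orbT.
Qed.

(** Induction on [#|A|], with the target set [B] variable. If a nonempty proper subset [X] is tight,
    match [X] into its own neighbours and [A :\: X] into [B :\: rel_image X], where Hall's condition
    survives because [X :|: Y] satisfies it. If none is tight, every such subset has a spare
    neighbour, so any edge from [a] to [b] can be used and [b] deleted. *)
Lemma hall (u0 : U) (A : {set T}) (B : {set U}) :
  (forall X : {set T}, X \subset A -> #|X| <= #|rel_image X :&: B|) ->
  exists f : T -> U, {in A &, injective f} /\
    forall x, x \in A -> f x \in B /\ r x (f x).
Proof.
have [m] := ubnP #|A|; elim: m A B => // m IH A B leAm hallA.
have [->|[a aA]] := set_0Vmem A.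
  by exists (fun=> u0); split=> x; rewrite inE.
case: (boolP [exists X : {set T}, [&& X != set0, X \proper A &
                                   #|rel_image X :&: B| <= #|X|]]).
  case/existsP=> X /and3P[X0 XA tight].
  have [sXA ltXA] := (proper_sub XA, proper_card XA).
  have [|Y sYX|f1 [inj1 f1P]] := IH X B.
  - by apply: leq_trans ltXA _.
  - by apply/hallA/(subset_trans sYX).
  have [|Y sYX|f2 [inj2 f2P]] := IH (A :\: X) (B :\: rel_image X).
  - have X1 : 0 < #|X| by rewrite card_gt0.
    have := cardsID X A; rewrite (setIidPr sXA); lia.
  - have [sYA dYX] : Y \subset A /\ [disjoint Y & X].
      by move: sYX; rewrite subsetD => /andP.
    have := hallA (X :|: Y); rewrite subUset sXA sYA => /(_ isT).
    rewrite cardsU setIC (disjoint_setI0 dYX) cards0 subn0 rel_imageU.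
    rewrite setIUl => le1.
    have : #|(rel_image X :&: B) :|: (rel_image Y :&: B)| <=
           #|rel_image X :&: B| + #|rel_image Y :&: (B :\: rel_image X)|.
      apply: leq_trans (leq_card_setU _ _); apply: subset_leq_card.
      apply/subsetP=> u; rewrite !in_setU !in_setI in_setD.
      by case: (u \in rel_image X); case: (u \in B); case: (u \in rel_image Y).
    lia.
  exists (fun x => if x \in X then f1 x else f2 x); split.
    have f12 x y : x \in X -> y \in A -> y \notin X -> f1 x <> f2 y.
      move=> xX yA yX eqf; have [|] := f2P y; first by rewrite !inE yX.
      rewrite -eqf in_setD => /andP[/negP nX _] _; apply/nX/rel_imageP.
      by exists x => //; case: (f1P x xX).
    move=> x y xA yA; case: ifPn => xX; case: ifPn => yX.
    + exact: inj1.
    + by move/(f12 _ _ xX yA yX).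
    + by move/esym/(f12 _ _ yX xA xX).
    + by apply: inj2; rewrite inE ?xX ?yX.
  move=> x xA; case: ifPn => xX; first exact: f1P.
  have [|] := f2P x; first by rewrite inE xX.
  by rewrite inE => /andP[].
rewrite negb_exists => /forallP loose.
have [b /setIP[/rel_imageP[_ /set1P-> rab] bB]] :
    exists b, b \in rel_image [set a] :&: B.
  apply/set0Pn; rewrite -card_gt0; apply: leq_trans (hallA _ _).
    by rewrite cards1.
  by rewrite sub1set.
have [|Y sYA|f [inj fP]] := IH (A :\ a) (B :\ b).
- by rewrite (cardsD1 a A) aA in leAm; lia.
- have [->|Y0] := eqVneq Y set0; first by rewrite cards0.
  have := loose Y; rewrite Y0 (sub_proper_trans sYA (properD1 aA)) /= -ltnNge.
  have := cardsD1 b (rel_image Y :&: B); rewrite setIDA; case: (_ \in _); lia.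
exists (fun x => if x == a then b else f x); split.
  have fb x : x \in A -> x != a -> b <> f x.
    move=> xA xa eqb; have [|] := fP x; first by rewrite !inE xa.
    by rewrite -eqb !inE eqxx.
  move=> x y xA yA; case: eqVneq => [->|xa]; case: eqVneq => [->|ya] //.
  - by move/(fb y yA ya).
  - by move/esym/(fb x xA xa).
  - by apply: inj; rewrite !inE ?xa ?ya.
move=> x xA; case: eqVneq => [->//|xa].
by have [|] := fP x; rewrite ?inE ?xa // => /andP[].
Qed.

End Hall.

(** Adding one star at a time matches the peeling of stars below. Leaves may be adjacent in [G]; the
    factor simply omits those edges. *)
Inductive star_cover (G : sgraph) (k : nat) : {set G} -> Prop :=
| star_cover0 : star_cover k set0
| star_coverU z (L A : {set G}) :
    0 < #|L| <= k -> (forall x, x \in L -> adj z x) ->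
    [disjoint z |: L & A] -> star_cover k A -> star_cover k (z |: L :|: A).

(** * Cutting a functional digraph into stars *)

Section StarCover.
Variables (G : sgraph) (k : nat) (f : G -> G).
Hypotheses (k_gt1 : 1 < k) (f_adj : forall x, adj x (f x)).
Hypothesis f_fibre : forall p, #|[set x | f x == p]| <= k.

Lemma star_coverD z (L A : {set G}) :
  0 < #|L| <= k -> (forall x, x \in L -> adj z x) -> z |: L \subset A ->
  star_cover k (A :\: (z |: L)) -> star_cover k A.
Proof.
move=> cardL adjL sLA coverA.
suff -> : A = (z |: L) :|: (A :\: (z |: L)).
  by apply: star_coverU => //; rewrite disjoint_sym disjoints_subset subsetDr.
by rewrite setDE setUIr setUCr setIT (setUidPr sLA).
Qed.

(** Stars are peeled off by strong induction on [#|A|]. Breaking a cycle leaves one vertex whose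
    image has been removed, so the induction must tolerate one exit [r], which may end up
    uncovered. *)
Lemma star_cover_closed_but (A : {set G}) (r : G) :
  (forall x, x \in A -> x != r -> f x \in A) ->
  star_cover k A \/ [/\ r \in A, f r \notin A & star_cover k (A :\ r)].
Proof.
have f_neq x : f x != x.
  by apply/eqP=> fx; have := f_adj x; rewrite fx adj_irrefl.
have [m] := ubnP #|A|; elim: m A r => // m IH A r leAm closedA.
pose fib p := [set x in A | f x == p].
have fibP x p : (x \in fib p) = (x \in A) && (f x == p) by rewrite inE.
have fib_le p : #|fib p| <= k.
  apply: leq_trans (f_fibre p); apply/subset_leq_card/subsetP=> x.
  by rewrite !inE => /andP[].
have ltD z (L : {set G}) : z |: L \subset A -> #|A :\: (z |: L)| < m.
  move=> sLA; rewrite cardsD (setIidPr sLA).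
  have := subset_leq_card sLA; have := cardsU1 z L.
  by have := subset_leq_card (subsetUl [set z] L); rewrite cards1; lia.
case: (boolP [exists p in A, (fib p != set0) &&
                [forall x in fib p, fib x == set0]]).
  case/exists_inP=> p pA /andP[fibp0 /forall_inP leaf].
  have sSA : p |: fib p \subset A.
    by rewrite subUset sub1set pA; apply/subsetP=> x; rewrite fibP => /andP[].
  have cardL : 0 < #|fib p| <= k by rewrite card_gt0 fibp0 fib_le.
  have adjL x : x \in fib p -> adj p x.
    by rewrite fibP => /andP[_ /eqP<-]; rewrite adj_sym.
  (* A remaining vertex maps neither to [p], whose preimages are all removed, nor into [fib p],
     whose elements have empty fibres; so no new exit appears. *)
  have stay x :
      x \in A :\: (p |: fib p) -> f x \in A -> f x \in A :\: (p |: fib p).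
    rewrite !in_setD !in_setU1 !negb_or => /andP[/andP[xp xfib] xA] fxA.
    rewrite fxA andbT; apply/andP; split.
      by apply: contra xfib => /eqP fx; rewrite fibP xA fx eqxx.
    by apply/negP=> /leaf/eqP/setP/(_ x); rewrite fibP xA eqxx inE.
  have [|x xA' xr|coverA'|[rA' frA' coverA']] := IH (A :\: (p |: fib p)) r.
  - exact: ltD.
  - by apply: stay => //; apply: closedA => //; case/setDP: xA'.
  - by left; exact: star_coverD coverA'.
  right; have rA : r \in A by case/setDP: rA'.
  split=> //; first by apply: contra frA'; exact: stay.
  apply: (@star_coverD p (fib p)) => //.
    apply/subsetP=> x xS; rewrite !inE (subsetP sSA) // andbT.
    by apply: contraTneq xS => ->; case/setDP: rA'.
  by rewrite setDDl setUC -setDDl.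
rewrite negb_exists_in => /forall_inP deep.
(* Every element of [C] now has a preimage in [C], so [f] permutes [C] by counting: what is left is
   cycles with pendant leaves, apart from a possible exit. *)
pose C := [set p in A | fib p != set0].
have CA : C \subset A by apply/subsetP=> p; rewrite inE => /andP[].
have child p : p \in C -> exists2 x, x \in C & f x = p.
  rewrite inE => /andP[pA fibp0]; have := deep p pA.
  rewrite fibp0 /= negb_forall_in => /exists_inP[x].
  by rewrite fibP => /andP[xA /eqP fx] fibx; exists x; rewrite // inE xA.
have sCf : C \subset f @: C.
  by apply/subsetP=> p /child[x xC <-]; exact: imset_f.
have card_fC : #|f @: C| = #|C|.
  by apply/eqP; rewrite eqn_leq leq_imset_card subset_leq_card.
have fC : f @: C = C.
  by apply/esym/eqP; rewrite eqEcard sCf card_fC leqnn.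
have f_inj : {in C &, injective f} by apply/imset_injP/eqP.
have inC x p : x \in A -> f x = p -> p \in A -> p \in C.
  by move=> xA fx pA; rewrite inE pA; apply/set0Pn; exists x; rewrite fibP xA fx eqxx.
(* [C] is stable under [f], so an exit [r] lies outside [C]: nothing in [A] maps to it, and [A :\ r]
   is closed. *)
case: (boolP ((r \in A) && (f r \notin A))) => [/andP[rA frA]|rNexit].
  have rC : r \notin C.
    apply: contra frA => rC; apply: (subsetP CA).
    by rewrite -fC; exact: imset_f.
  have [|x|coverA'|[]] := IH (A :\ r) r.
  - by move: leAm; rewrite (cardsD1 r A) rA.
  - rewrite !inE => /andP[xr xA] _; rewrite (closedA _ xA xr) andbT.
    by apply: contra rC => /eqP fx; apply: inC fx rA.
  - by right.
  - by rewrite !inE eqxx.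
left; have {rNexit closedA} closedA x : x \in A -> f x \in A.
  move=> xA; have [xr|/closedA->//] := eqVneq x r.
  by move: rNexit; rewrite -xr xA negbK.
have [->|[a aA]] := set_0Vmem A; first exact: star_cover0.
(* The pieces left are directed cycles with pendant leaves: break a cycle at
   [c], whose star must keep room for the predecessor [c'] of [c]. *)
suff [c [c' [L [[c'A fc' sLA] cardL adjL outL]]]] : exists c c' (L : {set G}),
    [/\ [/\ c' \in A, f c' = c & c |: L \subset A], 0 < #|L| < k,
        forall x, x \in L -> adj c x
      & forall x, x \in A -> x != c' -> x \notin c |: L -> f x \notin c |: L].
  have [|x|coverA'|[c'A' _ coverA']] := IH (A :\: (c |: L)) c'.
  - exact: ltD.
  - rewrite !in_setD => /andP[xL xA] xc'.
    by rewrite closedA // outL.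
  - by apply: star_coverD coverA' => //; lia.
  have c'L : c' \notin c |: L by case/setDP: c'A'.
  apply: (@star_coverD c (c' |: L)).
  - rewrite cardsU1; have -> : c' \notin L.
      by apply: contra c'L => c'L; rewrite in_setU1 c'L orbT.
    lia.
  - by move=> x /setU1P[->|/adjL//]; rewrite adj_sym -fc'.
  - by rewrite setUCA subUset sub1set c'A.
  - by rewrite setUCA setUC -setDDl.
(* If [c] has a preimage besides its cycle predecessor [c'], these other preimages form [L];
   dropping [c'] from the fibre gives [#|L| < k]. *)
case: (boolP [exists p in C, 1 < #|fib p|]).
  case/exists_inP=> c cC fib_gt1; have [c' c'C fc'] := child c cC.
  have c'fib : c' \in fib c by rewrite fibP fc' eqxx (subsetP CA).
  exists c, c', (fib c :\ c'); split.
  - split=> //; first exact: (subsetP CA).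
    rewrite subUset sub1set (subsetP CA) //=.
    by apply/subsetP=> x; rewrite !inE => /and3P[].
  - by have := cardsD1 c' (fib c); rewrite c'fib; have := fib_le c; lia.
  - by move=> x; rewrite !inE => /and3P[_ _ /eqP<-]; rewrite adj_sym.
  move=> x xA xc'; rewrite !inE xA xc' /= !negb_or => /andP[_ fxc].
  rewrite fxc /= negb_and negbK closedA //=.
  case: eqP => //= fxc'; apply/eqP=> ffx.
  have fxC : f x \in C by apply: inC (erefl _) (closedA _ xA).
  by apply: fxc'; apply: f_inj => //; rewrite ffx.
rewrite negb_exists_in => /forall_inP thin.
have cC : f a \in C by apply: inC (erefl _) (closedA _ aA).
have [c' c'C fc'] := child _ cC.
have thinP x y : x \in A -> y \in A -> f x = f y -> x = y.
  move=> xA yA fxy; have /thin : f y \in C by apply: inC (erefl _) (closedA _ yA).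
  rewrite -leqNgt => /card_le1_eqP; apply; by rewrite fibP ?xA ?yA ?fxy eqxx.
(* Here [f] is injective on [A], and the star is one cycle edge; [#|L| < k] holds since [1 < k]. On
   a cycle of length two, [c'] is the leaf itself and the exit case is vacuous. *)
exists (f a), c', [set f (f a)]; split.
- split=> //; first exact: (subsetP CA).
  by rewrite subUset !sub1set !closedA.
- by rewrite cards1.
- by move=> x /set1P->.
move=> x xA xc'; rewrite !inE !negb_or => /andP[xfa _]; apply/andP; split.
  by apply: contra xc' => /eqP fx; apply/eqP/thinP; rewrite ?fc' //; exact: (subsetP CA).
apply: contra xfa => /eqP fx; apply/eqP/thinP => //; exact: closedA.
Qed.

Lemma star_cover_setT : star_cover k [set: G].
Proof.
have [->|[r _]] := set_0Vmem [set: G]; first exact: star_cover0.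
have [x||[]] := @star_cover_closed_but [set: G] r; rewrite ?inE //.
Qed.

End StarCover.

(** * From star covers to factors *)

Lemma colour_bijection (T T' C : finType) (p : T -> C) (p' : T' -> C) :
  (forall c, #|[set x | p x == c]| = #|[set x | p' x == c]|) ->
  exists2 f : T -> T', bijective f & forall x, p' (f x) = p x.
Proof.
move=> eq_card.
have [y0|T'0] := pickP T'; last first.
  have T0 (x : T) : False.
    have : 0 < #|[set z | p z == p x]|.
      by rewrite card_gt0; apply/set0Pn; exists x; rewrite inE.
    by rewrite eq_card card_gt0 => /set0Pn[y]; have := T'0 y.
  exists (fun x => match T0 x with end) => [|x]; last by case: (T0 x).
  by apply: inj_card_bij => [x|]; [case: (T0 x) | rewrite (eq_card0 T'0)].
pose cls x := enum [set z | p z == p x].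
pose cls' x := enum [set z | p' z == p x].
(* The i-th element of a colour class goes to the i-th element of the class of the same colour. *)
pose f x := nth y0 (cls' x) (index x (cls x)).
have size_cls x : size (cls' x) = size (cls x) by rewrite -!cardE eq_card.
have idx x : index x (cls x) < size (cls' x).
  by rewrite size_cls index_mem mem_enum inE.
have fP x : p' (f x) = p x.
  by have := mem_nth y0 (idx x); rewrite mem_enum inE => /eqP.
exists f => //; apply: inj_card_bij.
  move=> x y fxy; have pxy : p x = p y by rewrite -!fP fxy.
  have : index x (cls x) == index y (cls x).
    have eq_cls : cls y = cls x by rewrite /cls pxy.
    have eq_cls' : cls' y = cls' x by rewrite /cls' pxy.
    rewrite -(nth_uniq y0 (idx x) _ (enum_uniq _)); last by rewrite -eq_cls -eq_cls'.
    by apply/eqP; move: fxy; rewrite /f eq_cls eq_cls'.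
  by move/eqP=> eqi; apply: (index_inj x _ _ eqi); rewrite /cls mem_enum inE ?pxy.
have cardE_sum (U : finType) (q : U -> C) : #|U| = \sum_c #|[set x | q x == c]|.
  rewrite -sum1_card (partition_big q xpredT) //=; apply: eq_bigr => c _.
  by rewrite -sum1_card; apply: eq_bigl => x; rewrite inE.
by rewrite (cardE_sum _ p) (cardE_sum _ p') (eq_bigr _ (fun c _ => eq_card c)).
Qed.

(** Used for stars, coloured by centre and leaf, and for split graphs, coloured by membership in [S]
    and [I]. *)
Lemma iso_of_colouring (C : finType) (Q : rel C) (G H : sgraph)
    (p : G -> C) (p' : H -> C) :
  (forall x y, adj x y = (x != y) && Q (p x) (p y)) ->
  (forall x y, adj x y = (x != y) && Q (p' x) (p' y)) ->
  (forall c, #|[set x | p x == c]| = #|[set x | p' x == c]|) -> iso G H.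
Proof.
move=> adjG adjH /colour_bijection[f bij_f fP].
exists f => // x y; rewrite adjG adjH !fP inj_eq //; exact: bij_inj.
Qed.

(** Encodes the cover as an idempotent map [c] whose fixed points are the centres and whose fibres
    are the stars; edges and components of the factor are then read off [c]. *)
Lemma star_cover_centre (G : sgraph) (k : nat) (A : {set G}) :
  star_cover k A -> exists c : G -> G, forall x, x \in A ->
    [/\ c x \in A, c (c x) = c x, x != c x -> adj (c x) x &
        0 < #|[set y in A | (c y == c x) && (y != c x)]| <= k].
Proof.
elim=> [|z L {}A cardL adjL disj _ [c cP]].
  by exists id => x; rewrite inE.
have zL : z \notin L by apply/negP=> /adjL; rewrite adj_irrefl.
have out x : x \in A -> x \notin z |: L.
  by move=> xA; apply: contraTN xA => /(disjointFr disj)->.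
pose c' x := if x \in z |: L then z else c x.
have c'z : c' z = z by rewrite /c' setU11.
have c'A x : x \in A -> c' x = c x by move=> xA; rewrite /c' (negbTE (out x xA)).
have cz x : x \in A -> c x != z.
  move=> xA; case: (cP x xA) => cxA _ _ _.
  by apply: contraTneq cxA => ->; rewrite (disjointFr disj) ?setU11.
exists c' => x; rewrite in_setU => /orP[xS|xA].
  have c'x : c' x = z by rewrite /c' xS.
  rewrite c'x c'z; split=> //; first by rewrite !inE eqxx.
    by case/setU1P: xS => [->|/adjL//]; rewrite eqxx.
  suff -> : [set y in z |: L :|: A | (c' y == z) && (y != z)] = L by [].
  apply/setP=> y; rewrite inE in_setU; case: (boolP (y \in z |: L)) => [yS|yS] /=.
    rewrite /c' yS eqxx /=; move: yS; rewrite in_setU1.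
    by case: eqVneq => // ->; rewrite (negbTE zL).
  rewrite /c' (negbTE yS); case: (boolP (y \in A)) => [/cz/negbTE->|_] /=;
    by apply/esym; apply: contraNF yS; rewrite in_setU1 orbC => ->.
have [cxA ccx adjx cardx] := cP x xA; rewrite !c'A //.
split=> //; first by rewrite in_setU cxA orbT.
suff -> : [set y in z |: L :|: A | (c' y == c x) && (y != c x)] =
          [set y in A | (c y == c x) && (y != c x)] by [].
apply/setP=> y; rewrite !inE -in_setU1; case: (boolP (y \in z |: L)) => [yS|yS] /=.
  by rewrite /c' yS eq_sym (negbTE (cz x xA)) (disjointFr disj yS).
by rewrite /c' (negbTE yS).
Qed.

Lemma star_cover_factor (G : sgraph) (k : nat) :
  star_cover k [set: G] -> has_factor (stars_upto k) G.
Proof.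
case/star_cover_centre=> c cP.
have cc x : c (c x) = c x by case: (cP x (in_setT x)).
(* Only edges between a centre and its own leaves are kept, so the components are the fibres of
   [c]. *)
pose e x y := [&& x != y, c x == c y & (c x == x) || (c x == y)].
have e_sym : symmetric e.
  move=> x y; rewrite /e eq_sym (eq_sym (c x)); case: eqVneq => //= _.
  by case: eqVneq => //= ->; rewrite orbC.
have e_irrefl : irreflexive e by move=> x; rewrite /e eqxx.
exists e, e_sym, e_irrefl; split.
  move=> x y /and3P[xy /eqP cxy].
  have [[_ _ adjx _] [_ _ adjy _]] := (cP x (in_setT x), cP y (in_setT y)).
  case/orP=> /eqP cx; last by rewrite adj_sym -cx adjx // cx.
  by move: adjy; rewrite -cxy cx => -> //; rewrite eq_sym.
move=> x; have [_ _ _] := cP x (in_setT x); set L := [set y in _ | _] => cardL.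
have connP y : connect e x y = (c y == c x).
  have e_c z : connect e z (c z).
    have [<-|zc] := eqVneq z (c z); first exact: connect0.
    by apply: connect1; rewrite /e zc cc !eqxx orbT.
  have connC : connect_sym e := sym_connect_sym e_sym.
  apply/idP/eqP=> [|cyx].
    case/connectP=> s + -> {y}.
    elim: s x {L cardL} => //= y s IH x /andP[/and3P[_ /eqP-> _]].
    exact: IH.
  by apply: connect_trans (e_c x) _; rewrite connC -cyx.
exists (star #|L|); first by exists #|L|.
pose p (u : component (x : SGraph e_sym e_irrefl)) := val u == c x.
pose p' (u : star #|L|) := if u is inl _ then true else false.
have compP (u : component (x : SGraph e_sym e_irrefl)) : c (val u) = c x.
  by case: u => u uP /=; apply/eqP; rewrite -connP; move: uP; rewrite inE.
apply: (iso_of_colouring (Q := fun a b => a != b) (p := p) (p' := p')).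
- move=> u v; rewrite -val_eqE /p /= /induced_rel /= /e !compP eqxx !(eq_sym (c x)) /=.
  case: (eqVneq (val u) (c x)) => [->|_] /=.
    by rewrite (eq_sym (c x)); case: (sval v == c x).
  by case: (sval v == c x).
- by move=> [u|u] [v|v]; rewrite /= /complete_rel ?(ord1 u) ?(ord1 v) ?eqxx ?andbF.
have card_col (U : finType) (q : U -> bool) b :
    #|[set y | q y == b]| = if b then #|[set y | q y]| else #|U| - #|[set y | q y]|.
  case: b; first by congr #|pred_of_set _|; apply/setP=> y; rewrite !inE eqb_id.
  rewrite -(cardsC [set y | q y]) addKn.
  by congr #|pred_of_set _|; apply/setP=> y; rewrite !inE eqbF_neg.
have p1 : #|[set u | p u]| = 1.
  have cxP : c x \in [set y | connect e x y] by rewrite inE connP cc.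
  rewrite -(cards1 (Sub (c x) cxP : component (x : SGraph e_sym e_irrefl))).
  by congr #|pred_of_set _|; apply/setP=> u; rewrite !inE -val_eqE.
have p'1 : #|[set u | p' u]| = 1.
  rewrite -(cards1 (inl ord0 : star #|L|)); congr #|pred_of_set _|.
  by apply/setP=> [[u|u]]; rewrite !inE // (ord1 u) eqxx.
have eq_card : #|component (x : SGraph e_sym e_irrefl)| = #|star #|L| |.
  rewrite card_sum !card_ord.
  rewrite card_sig.
  transitivity #|[set y | c y == c x]|.
    by apply: eq_card => y; rewrite !inE -connP.
  rewrite (cardsD1 (c x)) inE cc eqxx; congr (_ + #|pred_of_set _|).
  by apply/setP=> y; rewrite !inE andbC.
by move=> b; rewrite !card_col p1 p'1 eq_card.
Qed.

(** Apply Hall's theorem with [k] copies of each vertex as targets: an injection into the copies,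
    projected to [G], has fibres of size at most [k]. *)
Lemma star_cover_of_hall (G : sgraph) (k : nat) : 1 < k ->
  (forall X : {set G}, #|X| <= k * #|rel_image (@adj G) X|) ->
  star_cover k [set: G].
Proof.
case: k => // k k_gt1 hallG.
have [->|[x0 _]] := set_0Vmem [set: G]; first exact: star_cover0.
pose r (x : G) (u : G * 'I_k.+1) := adj x u.1.
have [|f [f_inj fP]] := @hall _ _ r (x0, ord0) [set: G] [set: G * 'I_k.+1].
  move=> X _; apply: leq_trans (hallG X) _.
  suff -> : rel_image r X = setX (rel_image (@adj G) X) [set: 'I_k.+1].
    by rewrite setIT cardsX cardsT card_ord mulnC.
  by apply/setP=> [[u i]]; rewrite in_setX !inE andbT.
apply: (@star_cover_setT _ _ (fun x => (f x).1)) => // [x|p].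
  by case: (fP x (in_setT x)).
rewrite -(card_in_imset (f := fun x => (f x).2)) => [|x y].
  by apply: leq_trans (max_card _) _; rewrite card_ord.
rewrite !inE => /eqP fx /eqP fy eq2; apply: f_inj => //.
by rewrite (surjective_pairing (f x)) (surjective_pairing (f y)) fx fy eq2.
Qed.

(* A vertex of [X] having a neighbour in [X] is itself in the neighbourhood
   of [X], so only the isolated vertices of [X] can violate Hall's condition. *)
Lemma star_factor_or_independent (G : sgraph) (k : nat) : 1 < k ->
  has_factor (stars_upto k) G \/
  exists I : {set G}, [disjoint I & rel_image (@adj G) I] /\
    k * #|rel_image (@adj G) I| < #|I|.
Proof.
move=> k_gt1; pose N := rel_image (@adj G).
case: (boolP [forall X : {set G}, #|X| <= k * #|N X|]) => [/forallP|].
  by move=> ?; left; apply/star_cover_factor/star_cover_of_hall.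
rewrite negb_forall => /existsP[X]; rewrite -ltnNge => ltX; right.
exists (X :\: N X); have sN : N (X :\: N X) \subset N X :\: (X :&: N X).
  apply/subsetP=> u /rel_imageP[x /setDP[xX xN] xu].
  have uN : u \in N X by apply/rel_imageP; exists x.
  rewrite !inE in uN *; rewrite uN !andbT; apply: contra xN => uX.
  by apply/rel_imageP; exists u; rewrite // adj_sym.
split.
  rewrite disjoint_sym disjoints_subset; apply: subset_trans sN _.
  by apply/subsetP=> u; rewrite !inE; case: (u \in X); case: [exists _ in _, _].
have := subset_leq_card sN.
have := cardsID (N X) X; have := cardsID (X :&: N X) (N X).
rewrite (setIidPr (subsetIr _ _)) -/N => e1 e2 le.
(* Discarding [X :&: N X] lowers the left side of Hall's inequality by its size and the right side
   by at least [k] times as much, so the violation persists. *)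
have : k * #|N (X :\: N X)| + k * #|X :&: N X| <= k * #|N X|.
  by rewrite -mulnDr leq_mul2l; apply/orP; right; lia.
have : #|X :&: N X| <= k * #|X :&: N X| by rewrite leq_pmull; lia.
lia.
Qed.

(** * Eigenvalues and positive supersolutions *)

Section Spectrum.
Variables (R : realType) (G : sgraph).
Local Open Scope ring_scope.

(** Passes from row vectors indexed by ordinals to functions on vertices; symmetry of [adj] makes
    the row product a sum over neighbours. *)
Lemma adjacency_eigenvalueP (a : R) :
  eigenvalue (adjacency R G) a <->
  exists2 w : G -> R, exists x, w x != 0 &
    forall x, \sum_(y | adj x y) w y = a * w x.
Proof.
have mulA (v : 'rV[R]_#|G|) j : (v *m adjacency R G) 0 j =
    \sum_(y | adj (enum_val j) y) v 0 (enum_rank y).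
  rewrite mxE [RHS]big_mkcond (reindex _ (onW_bij _ (enum_val_bij G))) /=.
  apply: eq_bigr => i _; rewrite mxE enum_valK adj_sym.
  by case: ifP; rewrite ?mulr1 ?mulr0.
split=> [/eigenvalueP[v vA v0]|[w [x wx0] wA]].
  exists (fun x => v 0 (enum_rank x)) => [|x].
    apply: contrapT => no_x; case/eqP: v0; apply/rowP=> i; rewrite mxE.
    apply: contrapT => vi; apply: no_x; exists (enum_val i).
    by rewrite enum_valK; apply/eqP.
  have := congr1 (fun u : 'rV_#|G| => u 0 (enum_rank x)) vA.
  by rewrite mulA enum_rankK mxE.
apply/eigenvalueP; exists (\row_i w (enum_val i)).
  apply/rowP=> j; rewrite mulA !mxE -wA; apply: eq_bigr => y _.
  by rewrite mxE enum_rankK.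
apply: contraNneq wx0 => /rowP/(_ (enum_rank x)).
by rewrite !mxE enum_rankK => ->.
Qed.

Let spectrum : seq R := rootsR (char_poly (adjacency R G)).

Let spectrumP (a : R) : eigenvalue (adjacency R G) a = (a \in spectrum).
Proof.
rewrite eigenvalue_root_char /spectrum.
by rewrite -(roots_on_rootsR (monic_neq0 (char_poly_monic _))) in_itv.
Qed.

Lemma le_spectral_radius (a : R) :
  eigenvalue (adjacency R G) a -> a <= spectral_radius R G.
Proof.
move=> eig_a; apply: ub_le_sup => //.
exists (\big[Order.max/0]_(b <- spectrum) b) => b /=; rewrite spectrumP => bs.
by apply: le_bigmax_seq bs _.
Qed.

(** The eigenvalues form a finite list. Positivity of [x] disposes of the default value 0, both of
    the maximum and of the supremum of an empty set. *)
Lemma spectral_radius_attained (x : R) : 0 < x -> x <= spectral_radius R G ->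
  exists2 a, eigenvalue (adjacency R G) a & x <= a.
Proof.
move=> x_gt0 le_x; apply: contrapT => no_a.
have lt_x a : a \in spectrum -> a < x.
  rewrite -spectrumP => eig_a; rewrite ltNge; apply/negP=> xa.
  by apply: no_a; exists a.
suff : spectral_radius R G <= \big[Order.max/0]_(b <- spectrum) b.
  move/(le_trans le_x); apply/negP; rewrite -ltNge.
  by rewrite big_seq; apply: bigmax_lt.
rewrite /spectral_radius.
have [->|/set0P E0] :=
  eqVneq [set a | eigenvalue (adjacency R G) a]%classic classical_sets.set0.
  by rewrite sup0; apply: bigmax_ge_id.
apply: ge_sup => // b /=; rewrite spectrumP => bs.
by apply: le_bigmax_seq bs _.
Qed.

End Spectrum.

Section MaximumPrinciple.
Local Open Scope ring_scope.
Variables (R : realFieldType) (T : finType) (g h : rel T).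
Variables (v w : T -> R) (x a : R).

(* [M] is the set of vertices where [|w| / v] is maximal: there the chain
   [a |w i| <= \sum_g |w j| <= \sum_h m v j <= x m v i <= a |w i|] is made of
   equalities. *)
Lemma maximum_principle :
  subrel g h -> (forall i, 0 < v i) -> 0 < x -> x <= a ->
  (forall i, \sum_(j | h i j) v j <= x * v i) ->
  (forall i, \sum_(j | g i j) w j = a * w i) ->
  (exists i, w i != 0) ->
  exists2 M : {set T}, M != set0 & forall i, i \in M ->
    \sum_(j | h i j) v j = x * v i /\ forall j, h i j -> g i j /\ j \in M.
Proof.
move=> sub_gh v_gt0 x_gt0 le_xa super eig [i0 wi0].
have [i1 m_max] : exists i1, forall j, `|w j| / v j <= `|w i1| / v i1.
  case: (@arg_maxP _ _ _ i0 xpredT (fun i => `|w i| / v i)) => //= i1 _ i1_max.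
  by exists i1 => j; exact: i1_max.
pose m := `|w i1| / v i1; have m_i1 : `|w i1| / v i1 = m by [].
have m_gt0 : 0 < m by apply: lt_le_trans (m_max i0); rewrite divr_gt0 ?normr_gt0.
have w_le j : `|w j| <= m * v j by rewrite -ler_pdivrMr.
exists [set i | `|w i| == m * v i].
  by apply/set0Pn; exists i1; rewrite inE -m_i1 divfK // lt0r_neq0.
move=> i; rewrite inE => /eqP wi.
have step1 : a * `|w i| <= \sum_(j | g i j) `|w j|.
  rewrite -[a]gtr0_norm; last exact: lt_le_trans le_xa.
  by rewrite -normrM -eig; apply: ler_norm_sum.
have vi := v_gt0 i.
pose F j := m * v j - (if g i j then `|w j| else 0).
have F_ge0 j : h i j -> 0 <= F j.
  move=> _; rewrite /F; case: ifP => _; first by rewrite subr_ge0.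
  by rewrite subr0 mulr_ge0 // ltW.
have sumF : \sum_(j | h i j) F j =
    m * (\sum_(j | h i j) v j) - \sum_(j | g i j) `|w j|.
  rewrite /F sumrB mulr_sumr -big_mkcondr; congr (_ - _).
  by apply: eq_bigl => j /=; case: (boolP (g i j)) => [/sub_gh->|]; rewrite ?andbF.
have sumF_ge0 : 0 <= \sum_(j | h i j) F j by apply: sumr_ge0.
have up : m * (\sum_(j | h i j) v j) <= m * (x * v i) by rewrite ler_pM2l.
have xa : x * `|w i| <= a * `|w i| by rewrite ler_wpM2r.
have mxv : m * (x * v i) = x * `|w i| by rewrite wi; ring.
split.
  apply: (mulfI (lt0r_neq0 m_gt0)); lra.
have sumF0 : \sum_(j | h i j) F j = 0 by lra.
move=> j hij; have := psumr_eq0P F_ge0 sumF0 hij.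
have := mulr_gt0 m_gt0 (v_gt0 j).
rewrite /F; case: ifP => _ mv_gt0 F0; last by lra.
by split=> //; rewrite inE; apply/eqP; lra.
Qed.

End MaximumPrinciple.

(** * Split graphs and weights constant on their parts *)

Section SplitRel.
Variables (T : finType) (S I : {set T}).

(* The join of a clique on [S] with the disjoint union of the edgeless graph
   on [I] and a clique on the remaining vertices. *)
Definition split_rel : rel T := fun i j =>
  (i != j) && [|| i \in S, j \in S | (i \notin I) && (j \notin I)].

Definition split_weight (R : numDomainType) (t y : R) (i : T) : R :=
  (if i \in S then 1 else if i \in I then t else y)%R.

Hypothesis disSI : [disjoint S & I].
Variables (R : numDomainType) (t y : R).
Local Notation v := (split_weight t y).
Local Notation b := (#|T| - #|S| - #|I|).
Local Open Scope ring_scope.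

Lemma sum_split_weight : \sum_i v i = #|S|%:R + b%:R * y + #|I|%:R * t.
Proof.
have SI i : i \in I -> i \in S = false by move=> iI; rewrite (disjointFl disSI).
rewrite (bigID (mem S)) /= (bigID (mem I) (fun i => i \notin S)) /=.
have -> : \sum_(i in S) v i = #|S|%:R.
  by rewrite -sumr_const; apply: eq_bigr => i; rewrite /split_weight => ->.
have -> : \sum_(i | (i \notin S) && (i \in I)) v i = #|I|%:R * t.
  rewrite mulr_natl -sumr_const; apply: eq_big => i.
    by case: (boolP (i \in I)) => [/SI->|]; rewrite ?andbF.
  by rewrite /split_weight => /andP[/negbTE-> ->].
rewrite -addrA; congr (_ + _); rewrite addrC; congr (_ + _).
have -> : b = #|~: (S :|: I)|.
  by rewrite [RHS]cardsCs setCK cardsU disjoint_setI0 // cards0 subn0 subnDA.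
rewrite mulr_natl -sumr_const; apply: eq_big => i.
  by rewrite !inE negb_or.
by rewrite /split_weight => /andP[/negbTE-> /negbTE->].
Qed.

Lemma split_row_S i : i \in S ->
  \sum_(j | split_rel i j) v j = #|S|%:R + b%:R * y + #|I|%:R * t - 1.
Proof.
move=> iS; have vi : v i = 1 by rewrite /split_weight iS.
rewrite -sum_split_weight [X in _ = X - _](bigD1 i) //= vi [1 + _]addrC addrK;
 apply: eq_bigl => j.
by rewrite /split_rel iS eq_sym andbT.
Qed.

Lemma split_row_I i : i \in I -> \sum_(j | split_rel i j) v j = #|S|%:R.
Proof.
move=> iI; have iS : i \in S = false by rewrite (disjointFl disSI).
rewrite -sumr_const; apply: eq_big => j; rewrite /split_rel iS iI.
  by rewrite orbF andbC; case: eqVneq => [<-|]; rewrite ?iS ?andbT.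
by rewrite /= orbF /split_weight => /andP[_ ->].
Qed.

Lemma split_row_B i : i \notin S -> i \notin I ->
  \sum_(j | split_rel i j) v j = #|S|%:R + b%:R * y - y.
Proof.
move=> iS iI; have := sum_split_weight; rewrite (bigID (mem I)) /=.
have -> : \sum_(j in I) v j = #|I|%:R * t.
  rewrite mulr_natl -sumr_const; apply: eq_bigr => j jI.
  by rewrite /split_weight (disjointFl disSI jI) jI.
have vi : v i = y by rewrite /split_weight (negbTE iS) (negbTE iI).
rewrite addrC => /addIr <-.
rewrite [X in _ = X - _](bigD1 i) //= vi [y + _]addrC addrK; apply: eq_bigl => j.
rewrite /split_rel (negbTE iS) iI /= eq_sym andbC; congr (_ && _).
by case: (boolP (j \in S)) => //= jS; rewrite (disjointFr disSI jS).
Qed.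

End SplitRel.

Lemma split_iso (G H : sgraph) (S I : {set G}) (S' I' : {set H}) :
  [disjoint S & I] -> [disjoint S' & I'] ->
  #|S| = #|S'| -> #|I| = #|I'| -> #|G| = #|H| ->
  @adj G =2 split_rel S I -> @adj H =2 split_rel S' I' -> iso G H.
Proof.
move=> disSI disSI' eqS eqI eqT adjG adjH.
pose Q (u w : bool * bool) := [|| u.1, w.1 | ~~ u.2 && ~~ w.2].
apply: (iso_of_colouring (Q := Q) (p := fun x => (x \in S, x \in I))
          (p' := fun x => (x \in S', x \in I'))) => // c.
have cardE (U : finType) (A B : {set U}) (dAB : [disjoint A & B]) :
    #|[set x | (x \in A, x \in B) == c]| =
    if c.1 then if c.2 then 0 else #|A|
    else if c.2 then #|B| else #|U| - #|A| - #|B|.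
  have BA i : i \in B -> i \in A = false by move=> iB; rewrite (disjointFl dAB).
  have -> : #|U| - #|A| - #|B| = #|~: (A :|: B)|.
    by rewrite [RHS]cardsCs setCK cardsU disjoint_setI0 // cards0 subn0 subnDA.
  case: c => [[] []] /=; last 3 first.
  - congr #|pred_of_set _|; apply/setP=> i; rewrite !inE xpair_eqE eqb_id eqbF_neg.
    by case: (boolP (i \in B)) => [/BA->|]; rewrite ?andbF ?andbT.
  - congr #|pred_of_set _|; apply/setP=> i; rewrite !inE xpair_eqE eqb_id eqbF_neg.
    by case: (boolP (i \in B)) => [/BA->|]; rewrite ?andbF ?andbT.
  - congr #|pred_of_set _|; apply/setP=> i; rewrite !inE xpair_eqE !eqbF_neg.
    by rewrite negb_or.
  apply/eqP; rewrite cards_eq0; apply/eqP/setP=> i; rewrite !inE xpair_eqE !eqb_id.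
  by case: (boolP (i \in B)) => [/BA->|]; rewrite ?andbF.
by rewrite !cardE // eqS eqI eqT.
Qed.

Lemma extremal_split (k n d : nat) : k * d + d + 1 <= n ->
  exists S I : {set extremal k n d},
    [/\ [disjoint S & I], #|S| = d, #|I| = k * d + 1, #|extremal k n d| = n &
        @adj (extremal k n d) =2 split_rel S I].
Proof.
move=> le_n.
pose S : {set extremal k n d} := inl @: [set: 'I_d].
pose I : {set extremal k n d} := (inr \o inr) @: [set: 'I_(k * d + 1)].
have inS u : u \in S = if u is inl _ then true else false.
  by case: u => u; [apply: imset_f | apply/imsetP=> -[]].
have inI u : u \in I = if u is inr (inr _) then true else false.
  by case: u => [u|[u|u]]; apply/imsetP; [case | case | exists u].
exists S, I; split.
- rewrite -setI_eq0; apply/eqP/setP=> u; rewrite !inE inS inI.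
  by case: u.
- by rewrite card_imset ?cardsT ?card_ord // => i j [].
- by rewrite card_imset ?cardsT ?card_ord // => i j [].
- by rewrite !card_sum !card_ord; lia.
by move=> [u|[u|u]] [v|[v|v]]; rewrite /split_rel !inS !inI /= ?andbF ?andbT ?orbT.
Qed.

(** * Comparison with the extremal graph *)

Section CharacteristicEquation.
Local Open Scope ring_scope.

(** The equation is the eigenvalue equation at a vertex of [S] after clearing denominators, see
    [split_eigen_S]. The cubic changes sign between [n - k * d - 2], the spectral radius of the
    clique off the independent set, and [n - 2]. *)
Lemma extremal_root (R : rcfType) (k n d : R) :
  2 <= k -> 1 <= d -> 3 * (k + 1) * d + 5 <= n ->
  exists2 x, n - k * d - 2 < x < n - 2 &
    (k * d + 1) * d * (d + (x - (n - k * d - 2))) =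
    (x - (n - k * d - 2)) * x * (x + 1).
Proof.
move=> k2 d1 le_n; set l := n - k * d - 2.
have kd : 2 <= k * d by nra.
pose c := (k * d + 1) * d.
pose p := ('X - l%:P) * 'X * ('X + 1) - c *: (d%:P + ('X - l%:P)).
have pE x : p.[x] = (x - l) * x * (x + 1) - c * (d + (x - l)).
  by rewrite /p !hornerE.
have pl : p.[l] < 0 by rewrite pE /c; nra.
have lbig : 2 * (k * d) + 3 * d + 3 <= l by rewrite /l; nra.
have pr : 0 < p.[n - 2].
  have -> : n - 2 = l + k * d by rewrite /l; ring.
  rewrite pE /c; have -> : l + k * d - l = k * d by ring.
  (* Bounding [d + k * d] by [2 * (k * d)] lets a factor [k * d] come out of both terms of
     [p.[n - 2]]. *)
  have h1 : 0 < (l + k * d) * (l + k * d + 1) - (k * d + 1) * (d + d).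
    have : (k * d + 1) * (d + d) < (l + k * d) * (l + k * d + 1).
      apply: ltr_pM; lra.
    lra.
  have h2 : (k * d + 1) * d * (d + k * d) <= (k * d) * ((k * d + 1) * (d + d)).
    have : 0 <= (k * d + 1) * d * (k * d - d) by rewrite mulr_ge0 //; nra.
    nra.
  nra.
have le_lr : l <= n - 2 by rewrite /l; lra.
have p_lr : p.[l] <= 0 <= p.[n - 2] by apply/andP; split; apply: ltW.
have [x /andP[lx xr] /rootP px] := Num.Theory.poly_ivt le_lr p_lr.
exists x; last by move: px; rewrite pE /c => px; lra.
rewrite !lt_def lx xr !andbT; apply/andP; split; apply/eqP=> eqx.
  by move: pl; rewrite -eqx px ltxx.
by move: pr; rewrite eqx px ltxx.
Qed.

(* With [P s] the difference of the two sides of the conclusion, the cubic [P]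
   vanishes at [d], and [P s / (s - d)] is a convex quadratic function which is
   negative at [0] and at [(n - 1) / (k + 1)]. *)
Lemma split_root_lt (R : realFieldType) (k n d s x : R) :
  2 <= k -> 1 <= d -> 3 * (k + 1) * d + 5 <= n ->
  n - k * d - 2 < x < n - 2 ->
  (k * d + 1) * d * (d + (x - (n - k * d - 2))) =
    (x - (n - k * d - 2)) * x * (x + 1) ->
  d < s -> (k + 1) * s + 1 <= n ->
  (k * s + 1) * s * (s + (x - (n - k * s - 2))) <
    (x - (n - k * s - 2)) * x * (x + 1).
Proof.
move=> k2 d1 le_n /andP[x_gt x_lt] eqx lt_ds le_s.
have k1_gt0 : 0 < k + 1 by lra.
(* The largest value that [(k + 1) * s + 1 <= n] allows for [s]. *)
pose m := (n - 1) / (k + 1).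
have nE : n = (k + 1) * m + 1 by rewrite /m mulrC divfK ?gt_eqF //; lra.
have le_sm : s <= m by rewrite /m ler_pdivlMr //; lra.
have m3 : 3 * d <= m by rewrite -(ler_pM2l k1_gt0); lra.
(* Multiplying [3 * (k + 1) * d + 4 <= (k + 1) * m] by [3 * k / (k + 1)] leaves the slack
   [12 * k / (k + 1)], at least 8 for [2 <= k]. *)
have dm : 9 * (k * d) <= 3 * (k * m) - 8.
  rewrite -(ler_pM2l k1_gt0).
  have : (k * 3) * (3 * (k + 1) * d + 4) <= (k * 3) * ((k + 1) * m).
    by rewrite ler_wpM2l; lra.
  by lra.
have m0 : 3 <= m by lra.
have Pm : (k * m + 1) * m < x * (x - m + 1).
  have le1 : (2 * (k * m) / 3 + 8 / 9) <= x - m + 1 by lra.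
  have le2 : (2 * (k * m) / 3 + m - 1 / 9) <= x by lra.
  have km : 6 <= k * m by nra.
  apply: lt_le_trans (ler_pM _ _ le2 le1); [|lra|lra].
  nra.
pose X := x * (x + 1); pose e := x - n + 2.
have X_gt0 : 0 < X by rewrite /X mulr_gt0; lra.
pose Q z := k * (k + 1) * (z ^+ 2 + z * d + d ^+ 2) +
  (k + 1 + k * e) * (z + d) + (e - k * X).
pose P z := (k * z + 1) * z * ((k + 1) * z + e) - (e + k * z) * X.
have Pd : P d = 0 by rewrite /P /X /e; lra.
have PQ z : P z = (z - d) * Q z.
  by apply/eqP; rewrite -subr_eq0 -[X in _ == X]Pd /P /Q; apply/eqP; ring.
have Q0 : Q 0 < 0.
  (* Both sides are [- P 0], and [e] is negative because [x < n - 2]. *)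
  have : d * Q 0 = e * X by have := PQ 0; rewrite /P; lra.
  have : e * X < 0 by rewrite nmulr_rlt0 // /e; lra.
  by move=> eX dQ; rewrite -(pmulr_rlt0 _ (lt_le_trans ltr01 d1)) dQ.
have Qm : Q m < 0.
  have md : 0 < m - d by lra.
  rewrite -(pmulr_rlt0 _ md) -PQ.
  have -> : P m = (x + 1) * ((k * m + 1) * m - x * (x - m + 1)).
    by rewrite /P /X /e nE; ring.
  by rewrite pmulr_rlt0; lra.
have Qs : Q s < 0.
  have m_gt0 : 0 < m by lra.
  rewrite -(pmulr_rlt0 _ m_gt0).
  (* Convexity as an exact identity: interpolation between 0 and [m], corrected by the leading
     coefficient [k * (k + 1)]. *)
  have -> : m * Q s = (m - s) * Q 0 + s * Q m - k * (k + 1) * (s * m * (m - s)).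
    by rewrite /Q; ring.
  have h1 : (m - s) * Q 0 <= 0 by rewrite mulr_ge0_le0; lra.
  have h2 : s * Q m < 0 by rewrite pmulr_rlt0 //; lra.
  have h3 : 0 <= k * (k + 1) * (s * m * (m - s)) by do 3?[apply: mulr_ge0]; lra.
  by rewrite subr_lt0; apply: lt_le_trans h3; apply: ltr_wnDl.
have : P s < 0 by rewrite PQ pmulr_rlt0 // subr_gt0.
rewrite /P /X /e; lra.
Qed.

End CharacteristicEquation.

(** * The positive weight attached to a split graph *)

Section SplitEigenvector.
Variables (R : realFieldType) (T : finType) (S I : {set T}) (k : nat) (x : R).
Hypotheses (disSI : [disjoint S & I]) (cardI : #|I| = k * #|S| + 1).
Local Open Scope ring_scope.
Let s : R := #|S|%:R.
Let u : R := x - (#|T|%:R - k%:R * s - 2).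
Hypotheses (s_gt0 : 0 < s) (x_gt0 : 0 < x) (u_gt0 : 0 < u).
Let v := split_weight S I (s / x) (s / (s + u)).

Lemma split_eigen_gt0 i : 0 < v i.
Proof.
have su : 0 < s + u by apply: addr_gt0.
by rewrite /v /split_weight; case: ifP => // _; case: ifP => _; rewrite divr_gt0.
Qed.

Let b_eq : (#|T| - #|S| - #|I|)%:R = x + 1 - u - s :> R.
Proof.
have le_SI : (#|S| + #|I| <= #|T|)%N.
  by rewrite -cardsUI disjoint_setI0 // cards0 addn0 max_card.
rewrite natrB; last lia.
rewrite natrB; last lia.
by rewrite cardI natrD natrM /u /s; ring.
Qed.

(** The two weights are chosen to solve these rows: [s = x * t] on [I], and
    [s + (x - u - s) * y = x * y] on the rest. *)
Lemma split_eigen_notS i : i \notin S ->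
  \sum_(j | split_rel S I i j) v j = x * v i.
Proof.
have su : s + u != 0 by apply: lt0r_neq0; apply: addr_gt0.
have x0 : x != 0 by apply: lt0r_neq0.
move=> iS; have [iI|iI] := boolP (i \in I).
  by rewrite split_row_I // /v /split_weight (negbTE iS) iI mulrC divfK.
rewrite split_row_B // b_eq /v /split_weight (negbTE iS) (negbTE iI) -/s.
by field.
Qed.

(** The one remaining row has a defect with the sign of the cubic: zero by [extremal_root] for
    [s = d], negative by [split_root_lt] for [s > d]. *)
Lemma split_eigen_S i : i \in S ->
  (\sum_(j | split_rel S I i j) v j - x * v i) * (x * (s + u)) =
  (k%:R * s + 1) * s * (s + u) - u * x * (x + 1).
Proof.
have su : s + u != 0 by apply: lt0r_neq0; apply: addr_gt0.
have x0 : x != 0 by apply: lt0r_neq0.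
move=> iS; rewrite split_row_S // b_eq cardI natrD natrM -/s /v /split_weight iS.
by field; apply/andP.
Qed.

End SplitEigenvector.

Section SpectralComparison.
Variable R : realType.
Local Open Scope ring_scope.

Lemma split_spectral (k n d : nat) (G : sgraph) (S I : {set G}) :
  (2 <= k)%N -> (0 < d)%N -> (3 * (k + 1) * d + 5 <= n)%N -> #|G| = n ->
  (d <= #|S|)%N -> [disjoint S & I] -> #|I| = (k * #|S| + 1)%N ->
  subrel (@adj G) (split_rel S I) ->
  spectral_radius R (extremal k n d) <= spectral_radius R G ->
  iso G (extremal k n d).
Proof.
move=> k2 d0 le_n cardG le_dS disSI cardI sub rho_le.
have le_kd : (k * d + d + 1 <= n)%N by nia.
have [S' [I' [disSI' cardS' cardI' cardH adjH]]] := extremal_split le_kd.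
have k2R : 2 <= k%:R :> R by rewrite ler_nat.
have d1R : 1 <= d%:R :> R by rewrite ler1n.
have le_nR : 3 * (k%:R + 1) * d%:R + 5 <= n%:R :> R.
  by rewrite -(ler_nat R) in le_n; move: le_n; rewrite !(natrD, natrM).
have [x x_itv eqx] := extremal_root k2R d1R le_nR.
have [x_gt x_lt] := andP x_itv.
have kd2 : 2 <= k%:R * d%:R :> R by nra.
have x_gt0 : 0 < x by nra.
have [a eig_a le_xa] : exists2 a, eigenvalue (adjacency R G) a & x <= a.
  apply: spectral_radius_attained => //; apply: le_trans rho_le.
  apply: le_spectral_radius; apply/adjacency_eigenvalueP.
  have u_gt0 : 0 < x - (#|extremal k n d|%:R - k%:R * #|S'|%:R - 2) :> R.
    by rewrite cardH cardS' subr_gt0.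
  have s_gt0 : 0 < #|S'|%:R :> R by rewrite cardS' ltr0n.
  have cardIS : #|I'| = (k * #|S'| + 1)%N by rewrite cardS'.
  pose v := split_weight S' I' (#|S'|%:R / x)
     (#|S'|%:R / (#|S'|%:R + (x - (#|extremal k n d|%:R - k%:R * #|S'|%:R - 2)))).
  exists v.
    have [i _] : exists i, i \in S' by apply/set0Pn; rewrite -card_gt0 cardS'.
    by exists i; apply/lt0r_neq0; exact: split_eigen_gt0.
  move=> i; rewrite (eq_bigl (split_rel S' I' i)); last by move=> j; exact: adjH.
  have [iS|iS] := boolP (i \in S'); last exact: split_eigen_notS.
  apply/eqP; rewrite -subr_eq0; apply/eqP.
  have xsu : x * (#|S'|%:R +
      (x - (#|extremal k n d|%:R - k%:R * #|S'|%:R - 2))) != 0.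
    by rewrite mulf_neq0 ?lt0r_neq0 // addr_gt0.
  apply: (mulIf xsu); rewrite mul0r (split_eigen_S disSI' cardIS s_gt0 x_gt0 u_gt0 iS).
  by rewrite cardH cardS' eqx subrr.
have [w w0 eig_w] := (adjacency_eigenvalueP G a).1 eig_a.
have le_SI : (#|S| + #|I| <= n)%N.
  by rewrite -cardsUI disjoint_setI0 // cards0 addn0 -cardG max_card.
have dSR : d%:R <= #|S|%:R :> R by rewrite ler_nat.
have s_gt0 : 0 < #|S|%:R :> R by lra.
have kdS : k%:R * d%:R <= k%:R * #|S|%:R :> R by rewrite ler_wpM2l.
have u_gt0 : 0 < x - (#|G|%:R - k%:R * #|S|%:R - 2) :> R by rewrite cardG; lra.
pose v := split_weight S I (#|S|%:R / x)
   (#|S|%:R / (#|S|%:R + (x - (#|G|%:R - k%:R * #|S|%:R - 2)))).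
have rowS i : i \in S -> \sum_(j | split_rel S I i j) v j <= x * v i
    ?= iff (d == #|S|).
  move=> iS.
  have xsu : 0 < x * (#|S|%:R + (x - (#|G|%:R - k%:R * #|S|%:R - 2))) :> R.
    by rewrite mulr_gt0 // addr_gt0.
  have := split_eigen_S disSI cardI s_gt0 x_gt0 u_gt0 iS; rewrite -/v.
  move: (\sum_(j | _) v j) => r rE.
  rewrite /Order.leif; case: (eqVneq d #|S|) => [dS|neq_dS].
    have : r - x * v i = 0.
      apply: (mulIf (lt0r_neq0 xsu)); rewrite mul0r rE cardG -dS eqx; ring.
    by move/subr0_eq->; split; rewrite ?lexx ?eqxx.
  suff lt_r : r < x * v i by split; [exact: ltW | rewrite lt_eqF].
  rewrite -subr_lt0 -(pmulr_llt0 _ xsu) rE subr_lt0 cardG.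
  apply: (split_root_lt k2R d1R le_nR x_itv eqx).
    by rewrite ltr_nat ltn_neqAle neq_dS.
  have : ((k + 1) * #|S| + 1 <= n)%N by rewrite mulnDl mul1n -addnA addnCA -cardI.
  by rewrite -(ler_nat R) !(natrD, natrM).
have super i : \sum_(j | split_rel S I i j) v j <= x * v i.
  have [/rowS[]//|iS] := boolP (i \in S).
  by rewrite (split_eigen_notS disSI cardI s_gt0 x_gt0 u_gt0 iS).
have v_gt0 i : 0 < v i by exact: split_eigen_gt0.
have [M M0 MP] := maximum_principle sub v_gt0 x_gt0 le_xa super eig_w w0.
have [z zS] : exists z, z \in S.
  by apply/set0Pn; rewrite -card_gt0; apply: leq_trans le_dS.
(* In the split graph [z] is adjacent to every other vertex, so [M], nonempty and closed under
   adjacency, contains [z]; equality in its row then gives [d = #|S|], and [M] is everything. *)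
have zM : z \in M.
  case/set0Pn: M0 => i iM; have [_ closedM] := MP i iM.
  have [<-//|iz] := eqVneq i z.
  by have [|] := closedM z; rewrite // /split_rel iz zS orbT.
have dS : d = #|S|.
  have [row_eq _] := MP z zM; have [_ /esym] := rowS z zS.
  by rewrite row_eq eqxx => /eqP.
have allM i : i \in M.
  have [->//|iz] := eqVneq i z; have [_ closedM] := MP z zM.
  by have [|] := closedM i; rewrite // /split_rel eq_sym iz zS.
have adjG : @adj G =2 split_rel S I.
  move=> i j; apply/idP/idP => [/sub//|hij].
  by have [_ /(_ j hij)[]] := MP i (allM i).
apply: (split_iso disSI disSI' _ _ _ adjG adjH); first by rewrite cardS'.
  by rewrite cardI cardI' dS.
by rewrite cardG cardH.
Qed.

(** For minimum degree 0 the set [S] is empty and the weights above vanish. The extremal graph is a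
    clique on [n - 1] vertices plus an isolated vertex, with eigenvalue [n - 2]. *)
Lemma isolated_spectral (k n : nat) (G : sgraph) (z : G) :
  (5 <= n)%N -> #|G| = n -> (forall x, ~~ adj z x) ->
  spectral_radius R (extremal k n 0) <= spectral_radius R G ->
  iso G (extremal k n 0).
Proof.
move=> le_n cardG z_isol rho_le.
have le_kd : (k * 0 + 0 + 1 <= n)%N by lia.
have [S' [I' [disSI' cardS' cardI' cardH adjH]]] := extremal_split le_kd.
have S'0 : S' = set0 by apply/eqP; rewrite -cards_eq0 cardS'.
rewrite muln0 add0n in cardI'.
pose x : R := n%:R - 2.
have n5 : 5 <= n%:R :> R by rewrite ler_nat.
have x_gt0 : 0 < x by rewrite /x; lra.
have rowB (H : sgraph) (J : {set H}) t i :
    #|H| = n -> #|J| = 1%N -> i \notin J ->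
    \sum_(j | split_rel set0 J i j) split_weight set0 J t 1 j = x.
  move=> cH cJ iJ; have dJ : [disjoint (set0 : {set H}) & J].
    by rewrite -setI_eq0 set0I.
  rewrite split_row_B // ?inE // cards0 cH cJ subn0 add0r mulr1 natrB; last lia.
  by rewrite /x; ring.
have rowI (H : sgraph) (J : {set H}) t i : i \in J ->
    \sum_(j | split_rel set0 J i j) split_weight set0 J t 1 j = 0 :> R.
  move=> iJ; have dJ : [disjoint (set0 : {set H}) & J].
    by rewrite -setI_eq0 set0I.
  by rewrite split_row_I // cards0.
have [a eig_a le_xa] : exists2 a, eigenvalue (adjacency R G) a & x <= a.
  apply: spectral_radius_attained => //; apply: le_trans rho_le.
  apply: le_spectral_radius; apply/adjacency_eigenvalueP.
  exists (split_weight set0 I' 0 1).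
    have [i iI] : exists i, i \in ~: I'.
      by apply/set0Pn; rewrite -card_gt0 cardsCs setCK cardH cardI'; lia.
    exists i; move: iI; rewrite in_setC /split_weight inE => /negbTE->.
    exact: oner_neq0.
  move=> i; rewrite (eq_bigl (split_rel set0 I' i)); last first.
    by move=> j; rewrite -S'0; exact: adjH.
  have [iI|iI] := boolP (i \in I').
    by rewrite rowI // /split_weight inE iI mulr0.
  by rewrite rowB // /split_weight inE (negbTE iI) mulr1.
have [w w0 eig_w] := (adjacency_eigenvalueP G a).1 eig_a.
pose J := [set z].
have sub : subrel (@adj G) (split_rel set0 J).
  move=> i j ij; rewrite /split_rel !inE /=.
  have iz : i != z by apply: contraTneq ij => ->; exact: z_isol.
  have jz : j != z by apply: contraTneq ij => ->; rewrite adj_sym; exact: z_isol.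
  by rewrite iz jz /= andbT; apply: contraTneq ij => ->; rewrite adj_irrefl.
(* Weight 1 at [z] too keeps the vector positive; the row of [z] is strict, so [M] avoids [z] and
   fills the clique. *)
have v_gt0 i : 0 < split_weight set0 J 1 1 i :> R.
  by rewrite /split_weight inE if_same.
have super i : \sum_(j | split_rel set0 J i j) split_weight set0 J 1 1 j
    <= x * split_weight set0 J 1 1 i.
  have [iJ|iJ] := boolP (i \in J); first by rewrite rowI // mulr_ge0 // ltW.
  by rewrite rowB ?cards1 // /split_weight inE (negbTE iJ) mulr1.
have [M M0 MP] := maximum_principle sub v_gt0 x_gt0 le_xa super eig_w w0.
have MJ i : i \in M -> i \notin J.
  case/MP => row_i _; apply/negP=> /rowI rowi0; move: row_i; rewrite rowi0.
  by apply/eqP; rewrite lt_eqF // mulr_gt0.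
have allM i : i \notin J -> i \in M.
  move=> iJ; case/set0Pn: M0 => j jM; have [<-//|ji] := eqVneq j i.
  have [_ closedM] := MP j jM; have jJ := MJ j jM.
  by have [|] := closedM i; rewrite // /split_rel ji iJ jJ !inE.
have adjG : @adj G =2 split_rel set0 J.
  move=> i j; apply/idP/idP => [/sub//|hij].
  have iJ : i \notin J.
    by move: hij; rewrite /split_rel !inE /= => /andP[_ /andP[]].
  by have [_ /(_ j hij)[]] := MP i (allM i iJ).
apply: (split_iso _ disSI' _ _ _ adjG adjH).
- by rewrite -setI_eq0 set0I.
- by rewrite cards0 cardS'.
- by rewrite cards1 cardI'.
by rewrite cardG cardH.
Qed.

End SpectralComparison.

(** * Minimum degree and conclusion *)

Lemma min_degree_le (G : sgraph) (x : G) : min_degree G <= degree x.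
Proof.
rewrite /min_degree -minEnat; exact: (@bigmin_le _ nat).
Qed.

Lemma min_degree_attained (G : sgraph) : 0 < #|G| ->
  exists x : G, degree x = min_degree G.
Proof.
move=> G_gt0; suff [eqG|//] :
  min_degree G = #|G| \/ exists x : G, degree x = min_degree G.
  case/card_gt0P: G_gt0 => x _; have := min_degree_le x; rewrite eqG leqNgt.
  suff -> : degree x < #|G| by [].
  rewrite -[#|G|]cardsT; apply/proper_card; rewrite properT.
  by apply/eqP=> /setP/(_ x); rewrite !inE adj_irrefl.
rewrite /min_degree; elim/big_ind: _ => [|m1 m2 h1 h2|x _]; first by left.
  by rewrite /minn; case: ifP.
by right; exists x.
Qed.

Theorem theorem1p8 (R : realType) (k n delta : nat) (G : sgraph) :
  2 <= k ->
  #|G| = n ->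
  min_degree G = delta ->
  3 * (k + 1) * delta + 5 <= n ->
  (spectral_radius R (extremal k n delta) <= spectral_radius R G)%R ->
  ~ iso G (extremal k n delta) ->
  has_factor (stars_upto k) G.
Proof.
move=> k2 cardG min_deg le_n rho_le not_iso.
have [//|[J [disJ ltJ]]] := star_factor_or_independent G k2.
exfalso; apply: not_iso.
have [d0|d_gt0] := posnP delta.
  have [|z deg_z] := @min_degree_attained G; first by lia.
  rewrite d0 in rho_le le_n *; apply: (@isolated_spectral R k n G z) => //.
    by lia.
  move=> x; apply/negP=> zx; move: deg_z; rewrite min_deg d0 => /eqP.
  by rewrite cards_eq0 => /eqP/setP/(_ x); rewrite !inE zx.
set S := rel_image (@adj G) J in disJ ltJ.
(* [J] is trimmed to the exact size, while [S] remains the neighbourhood of all of [J] and so still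
   contains that of [I]. *)
have [I sIJ cardI] : exists2 I : {set G}, I \subset J & #|I| = k * #|S| + 1.
  have /card_geqP[r [r_uniq size_r sub_r]] : k * #|S| + 1 <= #|J| by lia.
  exists [set x in r]; first by apply/subsetP=> x; rewrite inE; apply: sub_r.
  by rewrite cardsE (card_uniqP r_uniq).
have disSI : [disjoint S & I] by rewrite disjoint_sym (disjointWl sIJ).
have nbrI x y : x \in I -> adj x y -> y \in S.
  by move=> xI xy; apply/rel_imageP; exists x; rewrite // (subsetP sIJ).
apply: (@split_spectral R k n delta G S I) => //.
  (* All neighbours of a vertex of [I] lie in [S], whence [delta <= #|S|]. *)
  have [x xI] : exists x, x \in I by apply/set0Pn; rewrite -card_gt0 cardI; lia.
  rewrite -min_deg; apply: leq_trans (min_degree_le x) _.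
  by apply/subset_leq_card/subsetP=> y; rewrite inE; apply: nbrI.
move=> x y xy; rewrite /split_rel; apply/andP; split.
  by apply: contraTneq xy => ->; rewrite adj_irrefl.
have [xI|xI] := boolP (x \in I); first by rewrite (nbrI x y xI xy) !orbT.
have [yI|yI] := boolP (y \in I); last by rewrite !orbT.
by rewrite (nbrI y x yI) // adj_sym.
Qed.
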